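(* Consider the two-stage game with the linearly weighted reputation payment scheme and the operator's design problem described in the context. Assume that $b\bar x>\sqrt{C\,S(\bar x)}$. Then, for a given $\omega\in(0,1]$: (i) The optimal reputation parameters for the operator are $\gamma=0$ and $h=\dfrac{b\bar x}{\omega}$. (ii) For $\omega\neq1$, the operator will incentivize the effort level $\bar x$ at the first stage and the effort $x^*$ at the second stage, where $\dfrac{\partial S}{\partial x}(x^* )=b$. (iii) The optimal actions are as follows. The operator verifies the sensor with probabilities $p_2=1$ and $p_1=\dfrac{\omega}{1+(1-\omega)\delta}$. The sensor is truthful with probabilities $q_2=1-\dfrac{C}{b\bar x}$ and $q_1=1-\dfrac{\omega}{1+(1-\omega)\delta}\,\dfrac{C}{b\bar x}$.
   Context: An operator hires a sensor for two stages $k=1,2$. Constants: maximal effort $\bar x>0$, unit effort cost $b>0$, verification cost $C>0$, discount factor $\delta\in(0,1)$, reputation weight $\omega$. The operator's benefit $S:[0,\bar x]\to\mathbb R$ is increasing, concave and differentiable with $S(0)=0$; $x^*\in[0,\bar x]$ denotes an effort with $\frac{\partial S}{\partial x}(x^* )=b$. The reputation function is $R(z)=hz/\bar x$ with design parameter $h$; a second design parameter is $\gamma\ge0$. At stage $k$ the sensor plays $T$ (exert effort $x_k\in[0,\bar x]$ at cost $bx_k$ and report truthfully) with probability $q_k$, or $NT$ (exert effort $0$, report $\bar x$) with probability $1-q_k$. The operator plays $V$ (verify perfectly at cost $C$) with probability $p_k$, or $NV$ with probability $1-p_k$. The stage score is $r_k=R(x_k)+\gamma$ for $(T,V)$, $r_k=R(x_k)$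 for $(T,NV)$, $r_k=0$ for $(NT,V)$, and $r_k=h$ for $(NT,NV)$. Payments to the sensor are $P_1=r_1$ and $P_2=(1-\omega)r_1+\omega r_2$ (the linearly weighted reputation scheme). The sensor's stage payoff is $P_k-bx_k$ under $T$ and $P_k$ under $NT$. The operator's stage payoff is $S(x_k)-P_k$ under $T$ and $-P_k$ under $NT$, minus $C$ if she verifies. Total utilities $U^S$ (sensor) and $U^P$ (operator) are (stage-1 payoff) $+\,\delta\,\cdot$ (stage-2 payoff). Given $(\omega,h,\gamma)$ and efforts $(x_1,x_2)$, the players play the mixed strategy equilibrium of this game, in which each player is indifferent between their two actions at each stage: $$p_2=\frac{h-R(x_2)+\frac1\omega bx_2}{h+\gamma},\quad p_1=\frac{h-R(x_1)+\frac{1}{1+(1-\omega)\delta}bx_1}{h+\gamma},\quad q_2=\frac{h-\frac1\omega C}{h+\gamma},\quad q_1=\frac{h-\frac{1}{1+(1-\omega)\delta}C}{h+\gamma}.$$ For these strategies to exist the operator has to pick $\omega h>C$. $\mathbb E[U^S(x_1,x_2)]$ and $\mathbb E[U^P(x_1,x_2)]$ denote the expected total utilities under these strategies. If the incentivized effort at some stage is $0$, the operator does not verify at that stage, and that stage is treated as her outside option, contributing $0$ to her utility. Operator's design problem for given $\omega$: choose $h,\gamma\ge0$ and desired efforts $(x_1,x_2)\in[0,\bar x]^2$ to maximize $\mathbb E[U^P(x_1,x_2)]$ subject to - incentive compatibility (IC): $\mathbb E[U^S(x_1,x_2)]\ge\mathbb E[U^S(x_1',x_2')]$ for all $(x_1',x_2')\in[0,\bar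 x]^2$ (so when the sensor is indifferent between efforts, he takes the one desired by the operator); - individual rationality (IR): $\mathbb E[U^P]\ge0$ and $\mathbb E[U^S]\ge0$. ''Optimal'' parameters, incentivized efforts and optimal actions refer to the solution of this problem and the corresponding $p_k,q_k$.
   Formalization: The claim is proved for solutions of the design problem whose second-stage incentivized effort is nonzero; if the operator may leave stage 2 to her outside option, the stated parameters can violate her individual rationality and a smaller h can be optimal. *)

(* Defs.v *)
From Stdlib Require Import Reals.
Open Scope R_scope.

Record params := Params {
  xbar : R;          (* maximal effort *)
  bcost : R;         (* unit effort cost b *)
  vcost : R;         (* verification cost C *)
  delta : R;         (* discount factor *)
  benefit : R -> R   (* S, only its values on [0, xbar] matter *)
}.

Definition effort (g : params) (x : R) : Prop := 0 <= x <= xbar g.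

(* The derivative is relative to [0, xbar], hence one-sided at 0 and xbar. *)
Definition marginal_benefit (g : params) (x l : R) : Prop :=
  D_in (benefit g) (fun _ => l) (effort g) x.

Record standing (g : params) : Prop := Standing {
  xbar_gt0 : 0 < xbar g;
  bcost_gt0 : 0 < bcost g;
  vcost_gt0 : 0 < vcost g;
  delta_in01 : 0 < delta g < 1;
  benefit_at0 : benefit g 0 = 0;
  benefit_incr : forall x y, effort g x -> effort g y ->
    x <= y -> benefit g x <= benefit g y;
  benefit_concave : forall x y t, effort g x -> effort g y -> 0 <= t <= 1 ->
    t * benefit g x + (1 - t) * benefit g y
      <= benefit g (t * x + (1 - t) * y);
  benefit_diff : forall x, effort g x -> exists l, marginal_benefit g x l
}.

(* Reputation parameters h and gamma, together with the efforts x1 and x2 of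
   the two stages. *)
Record design := Design { h : R; gamma : R; x1 : R; x2 : R }.

Inductive sensor_action := T | NT.
Inductive operator_action := V | NV.

Definition reputation (g : params) (d : design) (z : R) : R :=
  h d * z / xbar g.

Definition score (g : params) (d : design) (x : R)
    (s : sensor_action) (o : operator_action) : R :=
  match s, o with
  | T, V => reputation g d x + gamma d
  | T, NV => reputation g d x
  | NT, V => 0
  | NT, NV => h d
  end.

Definition payment1 (r1 : R) : R := r1.
Definition payment2 (omega r1 r2 : R) : R := (1 - omega) * r1 + omega * r2.

Definition effort_cost (g : params) (x : R) (s : sensor_action) : R :=
  match s with T => bcost g * x | NT => 0 end.

Definition sensor_utility (g : params) (omega : R) (d : design)
    (s1 : sensor_action) (o1 : operator_action)
    (s2 : sensor_action) (o2 : operator_action) : R :=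
  let r1 := score g d (x1 d) s1 o1 in
  let r2 := score g d (x2 d) s2 o2 in
  (payment1 r1 - effort_cost g (x1 d) s1)
  + delta g * (payment2 omega r1 r2 - effort_cost g (x2 d) s2).

(* A stage with incentivized effort x = 0 is the operator's outside option:
   it yields no benefit and no verification cost, and its score generates no
   payment, neither at that stage nor through the next one. *)
Definition unless_outside (x v : R) : R := if Req_EM_T x 0 then 0 else v.

Definition operator_score (g : params) (d : design) (x : R)
    (s : sensor_action) (o : operator_action) : R :=
  unless_outside x (score g d x s o).

Definition operator_gain (g : params) (x : R)
    (s : sensor_action) (o : operator_action) : R :=
  unless_outside x
    (match s with T => benefit g x | NT => 0 end
     - match o with V => vcost g | NV => 0 end).

Definition operator_utility (g : params) (omega : R) (d : design)
    (s1 : sensor_action) (o1 : operator_action)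
    (s2 : sensor_action) (o2 : operator_action) : R :=
  let r1 := operator_score g d (x1 d) s1 o1 in
  let r2 := operator_score g d (x2 d) s2 o2 in
  (operator_gain g (x1 d) s1 o1 - payment1 r1)
  + delta g * (operator_gain g (x2 d) s2 o2 - payment2 omega r1 r2).

(* Discounted total weight of the first-stage score in the two payments. *)
Definition weight1 (g : params) (omega : R) : R := 1 + (1 - omega) * delta g.

Definition p1 (g : params) (omega : R) (d : design) : R :=
  (h d - reputation g d (x1 d) + / weight1 g omega * (bcost g * x1 d))
  / (h d + gamma d).
Definition p2 (g : params) (omega : R) (d : design) : R :=
  (h d - reputation g d (x2 d) + / omega * (bcost g * x2 d))
  / (h d + gamma d).
Definition q1 (g : params) (omega : R) (d : design) : R :=
  (h d - / weight1 g omega * vcost g) / (h d + gamma d).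
Definition q2 (g : params) (omega : R) (d : design) : R :=
  (h d - / omega * vcost g) / (h d + gamma d).

Definition mix_sensor (q : R) (f : sensor_action -> R) : R :=
  q * f T + (1 - q) * f NT.
Definition mix_operator (p : R) (f : operator_action -> R) : R :=
  p * f V + (1 - p) * f NV.

Definition expectation (g : params) (omega : R) (d : design)
    (U : sensor_action -> operator_action ->
         sensor_action -> operator_action -> R) : R :=
  mix_sensor (q1 g omega d) (fun s1 => mix_operator (p1 g omega d) (fun o1 =>
  mix_sensor (q2 g omega d) (fun s2 => mix_operator (p2 g omega d) (fun o2 =>
    U s1 o1 s2 o2)))).

Definition EUS (g : params) (omega : R) (d : design) : R :=
  expectation g omega d (sensor_utility g omega d).
Definition EUP (g : params) (omega : R) (d : design) : R :=
  expectation g omega d (operator_utility g omega d).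

Definition incentive_compatible (g : params) (omega : R) (d : design) : Prop :=
  forall x1' x2', effort g x1' -> effort g x2' ->
    EUS g omega (Design (h d) (gamma d) x1' x2') <= EUS g omega d.

Record feasible (g : params) (omega : R) (d : design) : Prop := Feasible {
  h_ge0 : 0 <= h d;
  gamma_ge0 : 0 <= gamma d;
  x1_effort : effort g (x1 d);
  x2_effort : effort g (x2 d);
  strategies_exist : vcost g < omega * h d;
  IC : incentive_compatible g omega d;
  IR_operator : 0 <= EUP g omega d;
  IR_sensor : 0 <= EUS g omega d
}.

Definition optimal (g : params) (omega : R) (d : design) : Prop :=
  feasible g omega d /\
  forall d', feasible g omega d' -> EUP g omega d' <= EUP g omega d.

(* Main.v *)
Require Import Defs.
From Stdlib Require Import Reals Lra.
Open Scope R_scope.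

(** The equilibrium probabilities make each player indifferent, and this
    decouples the two stages.  The score of stage 1 enters the two payments
    with total discounted weight W = 1 + (1 - omega) delta, that of stage 2
    with weight delta omega, so both utilities are sums of stage utilities in
    which the score counts with weight w = W or w = omega (EUP_stages and
    EUS_stages).

    For the sensor, the expected stage utility is affine in the effort, with
    slope of the sign of w h - b xbar.  A positive effort at stage 2 therefore
    forces omega h >= b xbar, and since W >= omega, with equality only at
    omega = 1, it makes full effort strictly best at stage 1 unless omega = 1
    and h = b xbar (incentivized_efforts).

    For the operator, a stage with effort x <> 0 is worth, with u = w h and
    v = w gamma,
        (u - C) / (u + v) * (S x + u (1 - x / xbar)) - u.
    This strictly decreases with v, hence gamma = 0.  At x = xbar and v = 0 it
    is S xbar - C S xbar / u - u, which strictly decreases once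
    u > sqrt (C S xbar).  The hypothesis b xbar > sqrt (C S xbar) puts every
    admissible u in that range, so h is the smallest value inducing effort at
    stage 2, namely b xbar / omega (optimal_at_critical).  Replacing a design
    by one with these parameters keeps it feasible; this needs C < b xbar,
    which the same hypothesis gives once C < S xbar.  The latter follows from
    the operator's individual rationality, because a stage with positive effort
    is worth less than S xbar - C.

    With h = b xbar / omega and gamma = 0 the sensor is indifferent between
    all efforts at stage 2, whose value to the operator is, for x <> 0, an
    increasing affine function of S x - b x.  The optimal x thus maximizes this
    concave function on [0, xbar], and so does xstar.  If the two differ, the function is
    constant between them, so its derivative vanishes at x as well, even when
    x is an endpoint (max_stationary). *)

(** * Decoupling the two stages *)

(** The stakes u = w h and v = w gamma absorb the weight w with which the score
    of the stage enters the payments, so that one function serves both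
    stages. *)
Definition stage_value (g : params) (u v x : R) : R :=
  unless_outside x
    ((u - vcost g) / (u + v) * (benefit g x + u * (1 - x / xbar g)) - u).

(** Up to a positive factor, the slope of the sensor's expected stage utility
    in his effort. *)
Definition effort_margin (g : params) (w h : R) : R :=
  w * h - bcost g * xbar g.

Definition net_benefit (g : params) (x : R) : R := benefit g x - bcost g * x.

Definition stage_mean (p q : R) (f : sensor_action -> operator_action -> R) : R :=
  mix_sensor q (fun s => mix_operator p (f s)).

Lemma unless_outside_neq0 (x v : R) : x <> 0 -> unless_outside x v = v.
Proof. intros Hx; unfold unless_outside; now destruct (Req_EM_T x 0). Qed.

Lemma unless_outside_0 (v : R) : unless_outside 0 v = 0.
Proof. unfold unless_outside; now destruct (Req_EM_T 0 0). Qed.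

Lemma expectation_separable (g : params) (omega : R) (d : design)
    (f1 f2 : sensor_action -> operator_action -> R)
    (U : sensor_action -> operator_action ->
         sensor_action -> operator_action -> R) :
  (forall s1 o1 s2 o2, U s1 o1 s2 o2 = f1 s1 o1 + delta g * f2 s2 o2) ->
  expectation g omega d U =
    stage_mean (p1 g omega d) (q1 g omega d) f1
    + delta g * stage_mean (p2 g omega d) (q2 g omega d) f2.
Proof.
  intros HU.
  unfold expectation, stage_mean, mix_sensor, mix_operator; rewrite !HU; ring.
Qed.

(** The probability p of verification is arbitrary: the sensor's mixing makes
    the operator indifferent, so the value is the one of always verifying. *)
Lemma operator_stage_mean (g : params) (d : design) (w x p : R) :
  xbar g <> 0 -> w <> 0 -> h d + gamma d <> 0 ->
  stage_mean p ((h d - / w * vcost g) / (h d + gamma d))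
    (fun s o => operator_gain g x s o - w * operator_score g d x s o)
  = stage_value g (w * h d) (w * gamma d) x.
Proof.
  intros Hxb Hw Hhg.
  assert (w * h d + w * gamma d <> 0).
  { rewrite <- Rmult_plus_distr_l.
    now apply Rmult_integral_contrapositive_currified. }
  unfold stage_mean, mix_sensor, mix_operator, operator_gain, operator_score,
    stage_value, unless_outside, score, reputation.
  destruct (Req_EM_T x 0); field; auto.
Qed.

(** Symmetrically, the probability q of truthfulness is arbitrary, and the
    value is the one, w (1 - p) h, of never exerting effort. *)
Lemma sensor_stage_mean (g : params) (d : design) (w x q : R) :
  xbar g <> 0 -> w <> 0 -> h d + gamma d <> 0 ->
  stage_mean ((h d - reputation g d x + / w * (bcost g * x)) / (h d + gamma d)) q
    (fun s o => w * score g d x s o - effort_cost g x s)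
  = h d / (h d + gamma d)
    * (w * gamma d + effort_margin g w (h d) * (x / xbar g)).
Proof.
  intros Hxb Hw Hhg.
  unfold stage_mean, mix_sensor, mix_operator, score, effort_cost, reputation,
    effort_margin.
  field; auto.
Qed.

(** Stage 1 carries the weight [weight1] because its score is paid at once and
    again, with factor 1 - omega, in the discounted second payment. *)
Lemma EUP_stages (g : params) (omega : R) (d : design) :
  xbar g <> 0 -> omega <> 0 -> weight1 g omega <> 0 -> h d + gamma d <> 0 ->
  EUP g omega d =
    stage_value g (weight1 g omega * h d) (weight1 g omega * gamma d) (x1 d)
    + delta g * stage_value g (omega * h d) (omega * gamma d) (x2 d).
Proof.
  intros Hxb Hom HW Hhg; unfold EUP.
  rewrite (expectation_separable g omega d
    (fun s o => operator_gain g (x1 d) s o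
                - weight1 g omega * operator_score g d (x1 d) s o)
    (fun s o => operator_gain g (x2 d) s o
                - omega * operator_score g d (x2 d) s o)).
  - unfold q1, q2; now rewrite !operator_stage_mean.
  - intros; unfold operator_utility, payment1, payment2, weight1; ring.
Qed.

Lemma EUS_stages (g : params) (omega : R) (d : design) :
  xbar g <> 0 -> omega <> 0 -> weight1 g omega <> 0 -> h d + gamma d <> 0 ->
  EUS g omega d =
    h d / (h d + gamma d)
    * (weight1 g omega * gamma d
       + effort_margin g (weight1 g omega) (h d) * (x1 d / xbar g)
       + delta g * (omega * gamma d
                    + effort_margin g omega (h d) * (x2 d / xbar g))).
Proof.
  intros Hxb Hom HW Hhg; unfold EUS.
  rewrite (expectation_separable g omega d
    (fun s o => weight1 g omega * score g d (x1 d) s o - effort_cost g (x1 d) s)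
    (fun s o => omega * score g d (x2 d) s o - effort_cost g (x2 d) s)).
  - unfold p1, p2; rewrite !sensor_stage_mean by auto; ring.
  - intros; unfold sensor_utility, payment1, payment2, weight1; ring.
Qed.

(** * The primitives *)


Lemma full_cost_gt0 (g : params) : standing g -> 0 < bcost g * xbar g.
Proof.
  intros Hg; apply Rmult_lt_0_compat; [apply bcost_gt0 | apply xbar_gt0]; auto.
Qed.

Lemma effort_xbar (g : params) : standing g -> effort g (xbar g).
Proof. intros Hg; pose proof (xbar_gt0 g Hg); unfold effort; lra. Qed.

Lemma effort_0 (g : params) : standing g -> effort g 0.
Proof. intros Hg; pose proof (xbar_gt0 g Hg); unfold effort; lra. Qed.

Lemma benefit_ge0 (g : params) (x : R) :
  standing g -> effort g x -> 0 <= benefit g x.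
Proof.
  intros Hg Hx; rewrite <- (benefit_at0 g Hg).
  apply (benefit_incr g Hg); [now apply effort_0 | | apply Hx]; auto.
Qed.

Lemma benefit_le_xbar (g : params) (x : R) :
  standing g -> effort g x -> benefit g x <= benefit g (xbar g).
Proof.
  intros Hg Hx; apply (benefit_incr g Hg); auto using effort_xbar; apply Hx.
Qed.

Lemma effort_share (g : params) (x : R) :
  standing g -> effort g x ->
  0 <= x / xbar g <= 1 /\ x = x / xbar g * xbar g.
Proof.
  intros Hg [Hx0 Hx1]; pose proof (xbar_gt0 g Hg).
  assert (E : x = x / xbar g * xbar g) by (field; lra).
  split; [split|exact E].
  - apply Rmult_le_pos; [assumption | left; now apply Rinv_0_lt_compat].
  - apply Rmult_le_reg_r with (xbar g); lra.
Qed.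

Lemma effort_share_lt1 (g : params) (x : R) :
  standing g -> effort g x -> x <> xbar g -> x / xbar g < 1.
Proof.
  intros Hg Hx Hne; destruct (effort_share g x Hg Hx) as [[_ Ht] E].
  destruct Ht as [Ht|Ht]; [assumption|]; rewrite Ht in E; lra.
Qed.

Lemma effort_share_gt0 (g : params) (x : R) :
  standing g -> effort g x -> x <> 0 -> 0 < x / xbar g.
Proof.
  intros Hg Hx Hne; destruct (effort_share g x Hg Hx) as [[Ht _] E].
  destruct Ht as [Ht|Ht]; [assumption|]; rewrite <- Ht in E; lra.
Qed.

Lemma weight1_ge1 (g : params) (omega : R) :
  standing g -> omega <= 1 -> 1 <= weight1 g omega.
Proof. intros Hg Hom; unfold weight1; pose proof (delta_in01 g Hg); nra. Qed.

Lemma weight1_gt1 (g : params) (omega : R) :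
  standing g -> omega < 1 -> 1 < weight1 g omega.
Proof. intros Hg Hom; unfold weight1; pose proof (delta_in01 g Hg); nra. Qed.

(** * The value of one stage to the operator *)

(** In terms of the truthfulness probability q < 1, the stage is worth
    q (S x - u x / xbar - v) - C when the operator verifies: she gets at most
    S x and pays C for sure. *)
Lemma stage_value_lt_benefit (g : params) (u v x : R) :
  standing g -> effort g x -> x <> 0 -> vcost g < u -> 0 <= v ->
  stage_value g u v x < benefit g x - vcost g.
Proof.
  intros Hg Hx Hx0 Hu Hv; pose proof (vcost_gt0 g Hg) as HC.
  pose proof (effort_share_gt0 g x Hg Hx Hx0) as Ht.
  pose proof (benefit_ge0 g x Hg Hx) as HS.
  unfold stage_value; rewrite unless_outside_neq0 by assumption.
  set (t := x / xbar g) in *.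
  (* q is the probability that the sensor is truthful *)
  set (q := (u - vcost g) / (u + v)).
  assert (Hq0 : 0 < q) by (apply Rdiv_lt_0_compat; lra).
  assert (E : q * (u + v) = u - vcost g) by (unfold q; field; lra).
  assert (Hq1 : q < 1) by nra.
  assert (0 < q * (u * t)) by (apply Rmult_lt_0_compat; nra).
  nra.
Qed.

(** The bonus only enters the denominator of the truthfulness probability.
    Strictness comes from the factor S x + u (1 - x / xbar), positive because
    one of its terms is: the second one, or the first one at full effort. *)
Lemma stage_value_decreasing_bonus (g : params) (u v x : R) :
  standing g -> effort g x -> x <> 0 -> 0 < benefit g (xbar g) ->
  vcost g < u -> 0 < v ->
  stage_value g u v x < stage_value g u 0 x.
Proof.
  intros Hg Hx Hx0 HS Hu Hv; pose proof (vcost_gt0 g Hg) as HC.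
  unfold stage_value; rewrite !unless_outside_neq0 by assumption.
  apply Rplus_lt_compat_r, Rmult_lt_compat_r.
  - pose proof (benefit_ge0 g x Hg Hx).
    destruct (Req_dec x (xbar g)) as [->|Hne].
    + replace (xbar g / xbar g) with 1
        by (field; pose proof (xbar_gt0 g Hg); lra); lra.
    + pose proof (effort_share_lt1 g x Hg Hx Hne); nra.
  - apply Rmult_lt_compat_l; [lra|]; apply Rinv_lt_contravar; nra.
Qed.

Lemma stage_value_decreasing_bonus_le (g : params) (u v x : R) :
  standing g -> effort g x -> 0 < benefit g (xbar g) ->
  vcost g < u -> 0 <= v ->
  stage_value g u v x <= stage_value g u 0 x.
Proof.
  intros Hg Hx HS Hu [Hv|<-]; [|apply Rle_refl].
  destruct (Req_dec x 0) as [->|Hx0].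
  - unfold stage_value; rewrite !unless_outside_0; apply Rle_refl.
  - left; now apply stage_value_decreasing_bonus.
Qed.

(** With K = C S xbar, the value at full effort is S xbar - K / u - u, and
    K / u + u increases beyond the square root of K. *)
Lemma stage_value_decreasing_stake (g : params) (u u' : R) :
  standing g -> 0 < u -> u < u' -> vcost g * benefit g (xbar g) < u ^ 2 ->
  stage_value g u' 0 (xbar g) < stage_value g u 0 (xbar g).
Proof.
  intros Hg Hu Huu Hsq; pose proof (xbar_gt0 g Hg).
  unfold stage_value; rewrite !unless_outside_neq0 by lra.
  set (K := vcost g * benefit g (xbar g)) in *.
  replace (xbar g / xbar g) with 1 by (field; lra).
  apply Rlt_0_minus.
  (* (K / u' + u') - (K / u + u) factors as follows. *)
  match goal with |- _ < ?e =>
    replace e with ((u' - u) * (u * u' - K) / (u * u'))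
      by (unfold K; field; lra) end.
  apply Rdiv_lt_0_compat; [apply Rmult_lt_0_compat|]; nra.
Qed.

(** At the stake u = b xbar the expected payment for effort x just covers its
    cost b x, so the operator internalizes the surplus S x - b x. *)
Lemma stage_value_critical (g : params) (x : R) :
  standing g -> x <> 0 ->
  stage_value g (bcost g * xbar g) 0 x =
    (1 - vcost g / (bcost g * xbar g)) * net_benefit g x - vcost g.
Proof.
  intros Hg Hx; pose proof (xbar_gt0 g Hg); pose proof (bcost_gt0 g Hg).
  unfold stage_value, net_benefit; rewrite unless_outside_neq0 by assumption.
  field; lra.
Qed.

(** * Incentive compatibility *)

(** The positive factor h / (h + gamma) and the terms in gamma do not depend
    on the efforts, so incentive compatibility only concerns the linear part of
    the sensor's utility. *)
Lemma incentive_compatible_margins (g : params) (omega : R) (d : design) :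
  standing g -> 0 < omega <= 1 -> 0 <= gamma d -> vcost g < omega * h d ->
  incentive_compatible g omega d <->
  (forall y1 y2, effort g y1 -> effort g y2 ->
     effort_margin g (weight1 g omega) (h d) * (y1 / xbar g)
     + delta g * (effort_margin g omega (h d) * (y2 / xbar g))
     <= effort_margin g (weight1 g omega) (h d) * (x1 d / xbar g)
        + delta g * (effort_margin g omega (h d) * (x2 d / xbar g))).
Proof.
  intros Hg Hom Hga Hh.
  pose proof (vcost_gt0 g Hg); pose proof (xbar_gt0 g Hg).
  pose proof (weight1_ge1 g omega Hg (proj2 Hom)).
  assert (Hh0 : 0 < h d) by nra.
  assert (Hf : 0 < h d / (h d + gamma d)) by (apply Rdiv_lt_0_compat; lra).
  unfold incentive_compatible.
  split; intros HI y1 y2 Hy1 Hy2; specialize (HI y1 y2 Hy1 Hy2).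
  - rewrite !EUS_stages in HI by (simpl; lra); simpl in HI.
    apply Rmult_le_reg_l in HI; [lra|assumption].
  - rewrite !EUS_stages by (simpl; lra); simpl.
    apply Rmult_le_compat_l; lra.
Qed.

Lemma linear_argmax (g : params) (m x : R) :
  standing g -> effort g x ->
  (forall y, effort g y -> m * (y / xbar g) <= m * (x / xbar g)) ->
  (x <> 0 -> 0 <= m) /\ (0 < m -> x = xbar g).
Proof.
  intros Hg Hx Hmax; pose proof (xbar_gt0 g Hg); split.
  - intros Hx0; pose proof (effort_share_gt0 g x Hg Hx Hx0).
    specialize (Hmax 0 (effort_0 g Hg)).
    replace (0 / xbar g) with 0 in Hmax by (field; lra); nra.
  - intros Hm; specialize (Hmax _ (effort_xbar g Hg)).
    replace (xbar g / xbar g) with 1 in Hmax by (field; lra).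
    destruct (Req_dec x (xbar g)) as [|Hne]; [assumption|].
    pose proof (effort_share_lt1 g x Hg Hx Hne); nra.
Qed.

(** The two efforts are chosen separately: comparing with deviations at a
    single stage reduces to maximizing a linear function on [0, xbar]. *)
Lemma incentivized_efforts (g : params) (omega : R) (d : design) :
  standing g -> 0 < omega <= 1 -> feasible g omega d ->
  (x2 d <> 0 -> 0 <= effort_margin g omega (h d)) /\
  (0 < effort_margin g omega (h d) -> x2 d = xbar g) /\
  (0 < effort_margin g (weight1 g omega) (h d) -> x1 d = xbar g).
Proof.
  intros Hg Hom [_ Hga Hx1 Hx2 Hh HIC _ _].
  rewrite incentive_compatible_margins in HIC by auto.
  pose proof (delta_in01 g Hg) as Hde.
  assert (H2 := linear_argmax g (effort_margin g omega (h d)) (x2 d) Hg Hx2).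
  assert (H1 := linear_argmax g (effort_margin g (weight1 g omega) (h d))
                  (x1 d) Hg Hx1).
  destruct H2 as [H2a H2b].
  { intros y Hy; specialize (HIC (x1 d) y Hx1 Hy); nra. }
  destruct H1 as [_ H1b].
  { intros y Hy; specialize (HIC y (x2 d) Hy Hx2); nra. }
  tauto.
Qed.

(** * Optimal reputation parameters *)

(** Since C < S xbar, the geometric mean of C and S xbar exceeds C. *)
Lemma full_cost_gt_vcost (g : params) :
  standing g -> vcost g < benefit g (xbar g) ->
  bcost g * xbar g > sqrt (vcost g * benefit g (xbar g)) ->
  vcost g < bcost g * xbar g /\
  vcost g * benefit g (xbar g) < (bcost g * xbar g) ^ 2.
Proof.
  intros Hg HS Hbig; pose proof (vcost_gt0 g Hg).
  pose proof (full_cost_gt0 g Hg).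
  set (K := vcost g * benefit g (xbar g)) in *.
  assert (HK : 0 <= K) by (unfold K; nra).
  pose proof (sqrt_pos K); pose proof (sqrt_sqrt K HK).
  assert (Hlt : K < (bcost g * xbar g) ^ 2) by nra.
  split; [unfold K in Hlt; nra | assumption].
Qed.

(** The weight b xbar / omega is the smallest one that can induce effort at
    stage 2; there the sensor is indifferent between all second efforts. *)
Definition critical_design (g : params) (omega y1 y2 : R) : design :=
  Design (bcost g * xbar g / omega) 0 y1 y2.

(** The sensor is indifferent at stage 2, and prefers full effort at stage 1
    because [weight1] is at least omega; for omega = 1 he is indifferent there
    too, whence the freedom left on y1. *)
Lemma feasible_critical (g : params) (omega y1 y2 : R) :
  standing g -> 0 < omega <= 1 -> vcost g < bcost g * xbar g ->
  effort g y1 -> effort g y2 -> (omega <> 1 -> y1 = xbar g) ->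
  0 <= EUP g omega (critical_design g omega y1 y2) ->
  feasible g omega (critical_design g omega y1 y2).
Proof.
  intros Hg Hom HB Hy1 Hy2 Hfull HEUP.
  pose proof (vcost_gt0 g Hg); pose proof (xbar_gt0 g Hg).
  pose proof (weight1_ge1 g omega Hg (proj2 Hom)) as HW.
  assert (Hh : 0 < bcost g * xbar g / omega) by (apply Rdiv_lt_0_compat; lra).
  assert (E2 : omega * (bcost g * xbar g / omega) = bcost g * xbar g)
    by (field; lra).
  assert (Hm2 : effort_margin g omega (bcost g * xbar g / omega) = 0)
    by (unfold effort_margin; lra).
  assert (Hm1 : 0 <= effort_margin g (weight1 g omega) (bcost g * xbar g / omega))
    by (unfold effort_margin; nra).
  assert (Hm1' : omega = 1 ->
    effort_margin g (weight1 g omega) (bcost g * xbar g / omega) = 0).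
  { intros ->; unfold effort_margin, weight1; field. }
  constructor; simpl; auto; try lra.
  - rewrite incentive_compatible_margins by (simpl; auto; lra); simpl.
    intros z1 z2 Hz1 Hz2; rewrite Hm2.
    destruct (Req_dec omega 1) as [E|E].
    + rewrite (Hm1' E); lra.
    + rewrite (Hfull E).
      replace (xbar g / xbar g) with 1 by (field; lra).
      pose proof (effort_share g z1 Hg Hz1) as [[_ ?] _]; nra.
  - rewrite EUS_stages by (simpl; lra); simpl; rewrite Hm2.
    pose proof (effort_share g y1 Hg Hy1) as [[? _] _].
    apply Rmult_le_pos; [left; apply Rdiv_lt_0_compat; lra | nra].
Qed.

(** Individual rationality of the critical design need not be checked: where
    it fails, the comparison holds trivially. *)
Lemma optimal_ge_critical (g : params) (omega : R) (d : design) (y1 y2 : R) :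
  standing g -> 0 < omega <= 1 -> vcost g < bcost g * xbar g ->
  optimal g omega d ->
  effort g y1 -> effort g y2 -> (omega <> 1 -> y1 = xbar g) ->
  EUP g omega (critical_design g omega y1 y2) <= EUP g omega d.
Proof.
  intros Hg Hom HB [Hf Hopt] Hy1 Hy2 Hy.
  pose proof (IR_operator _ _ _ Hf).
  destruct (Rle_lt_dec (EUP g omega (critical_design g omega y1 y2))
              (EUP g omega d)) as [|Hlt]; [assumption|].
  apply Hopt, feasible_critical; auto; lra.
Qed.

Lemma EUP_critical (g : params) (omega y1 y2 : R) :
  standing g -> 0 < omega <= 1 ->
  EUP g omega (critical_design g omega y1 y2) =
    stage_value g (weight1 g omega * (bcost g * xbar g / omega)) 0 y1
    + delta g * stage_value g (bcost g * xbar g) 0 y2.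
Proof.
  intros Hg Hom; pose proof (xbar_gt0 g Hg).
  pose proof (full_cost_gt0 g Hg).
  pose proof (weight1_ge1 g omega Hg (proj2 Hom)) as HW.
  assert (Hh : 0 < bcost g * xbar g / omega) by (apply Rdiv_lt_0_compat; lra).
  rewrite EUP_stages by (simpl; lra); simpl; rewrite !Rmult_0_r.
  now replace (omega * (bcost g * xbar g / omega)) with (bcost g * xbar g)
    by (field; lra).
Qed.

(** Otherwise stage 2 would be worth less than 0 to the operator, and stage 1
    at most 0, against her individual rationality. *)
Lemma feasible_benefit_gt_vcost (g : params) (omega : R) (d : design) :
  standing g -> 0 < omega <= 1 -> feasible g omega d -> x2 d <> 0 ->
  vcost g < benefit g (xbar g).
Proof.
  intros Hg Hom [Hh0 Hga Hx1 Hx2 Hh _ Hir _] Hn2.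
  pose proof (vcost_gt0 g Hg); pose proof (xbar_gt0 g Hg).
  pose proof (delta_in01 g Hg).
  pose proof (weight1_ge1 g omega Hg (proj2 Hom)) as HW.
  rewrite EUP_stages in Hir by nra.
  assert (vcost g < weight1 g omega * h d) by nra.
  assert (0 <= weight1 g omega * gamma d) by nra.
  assert (0 <= omega * gamma d) by nra.
  pose proof (benefit_le_xbar g _ Hg Hx1); pose proof (benefit_le_xbar g _ Hg Hx2).
  pose proof (stage_value_lt_benefit g (omega * h d) (omega * gamma d) (x2 d)) as V2.
  destruct (Req_dec (x1 d) 0) as [E|Hn1].
  - rewrite E in Hir; unfold stage_value at 1 in Hir.
    rewrite unless_outside_0 in Hir.
    apply Rnot_le_lt; intros Hle; assert (V := V2 Hg Hx2 Hn2 Hh ltac:(assumption)).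
    nra.
  - pose proof (stage_value_lt_benefit g (weight1 g omega * h d)
      (weight1 g omega * gamma d) (x1 d)) as V1.
    apply Rnot_le_lt; intros Hle; assert (V := V2 Hg Hx2 Hn2 Hh ltac:(assumption)).
    assert (V' := V1 Hg Hx1 Hn1 ltac:(assumption) ltac:(assumption)).
    nra.
Qed.

(** Lowering h to b xbar / omega, then gamma to 0, raises the operator's value
    at stage 2 strictly and does not lower it at stage 1.  If h was larger,
    both efforts were full and remain incentive compatible; if h was already
    b xbar / omega, the efforts are kept as they are. *)
Lemma optimal_at_critical (g : params) (omega : R) (d : design) :
  standing g -> 0 < omega <= 1 ->
  bcost g * xbar g > sqrt (vcost g * benefit g (xbar g)) ->
  optimal g omega d -> x2 d <> 0 ->
  d = critical_design g omega (x1 d) (x2 d).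
Proof.
  intros Hg Hom Hbig Hoptd Hn2; assert (Hf := proj1 Hoptd).
  assert (HSC := feasible_benefit_gt_vcost g omega d Hg Hom Hf Hn2).
  destruct (full_cost_gt_vcost g Hg HSC Hbig) as [HBC HBS].
  destruct (incentivized_efforts g omega d Hg Hom Hf) as (Hm & Hf2 & Hf1).
  specialize (Hm Hn2).
  pose proof (vcost_gt0 g Hg); pose proof (xbar_gt0 g Hg).
  pose proof (delta_in01 g Hg).
  pose proof (weight1_ge1 g omega Hg (proj2 Hom)) as HW.
  destruct Hf as [Hh0 Hga He1 He2 Hh _ Hir _].
  assert (Hhpos : 0 < h d) by nra.
  assert (HEUP := EUP_stages g omega d ltac:(lra) ltac:(lra) ltac:(lra) ltac:(lra)).
  assert (HWh : vcost g < weight1 g omega * h d) by nra.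
  assert (HWg : 0 <= weight1 g omega * gamma d) by nra.
  assert (Hwg : 0 <= omega * gamma d) by nra.
  assert (Dg1 := stage_value_decreasing_bonus_le g _ _ (x1 d) Hg He1
                  ltac:(lra) HWh HWg).
  assert (Dg2 := stage_value_decreasing_bonus_le g _ _ (x2 d) Hg He2
                  ltac:(lra) Hh Hwg).
  assert (Hcomp := fun y1 y2 =>
    optimal_ge_critical g omega d y1 y2 Hg Hom HBC Hoptd).
  assert (Hh1 : h d = bcost g * xbar g / omega).
  { destruct Hm as [Hm|Hm]; [exfalso|unfold effort_margin in Hm;
      apply Rmult_eq_reg_l with omega; [|lra];
      replace (omega * (bcost g * xbar g / omega)) with (bcost g * xbar g)
        by (field; lra); lra].
    (* With h too large both efforts are full, and both stages can be improved. *)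
    assert (Hm1 : 0 < effort_margin g (weight1 g omega) (h d))
      by (unfold effort_margin in *; nra).
    assert (E1 := Hf1 Hm1); assert (E2 := Hf2 Hm); unfold effort_margin in *.
    rewrite E1, E2 in *.
    specialize (Hcomp _ _ He1 He1 ltac:(auto)).
    rewrite EUP_critical, HEUP in Hcomp by assumption.
    set (u0 := bcost g * xbar g / omega) in *.
    assert (Eu : omega * u0 = bcost g * xbar g) by (unfold u0; field; lra).
    assert (u0 < h d) by nra.
    assert (D2 := stage_value_decreasing_stake g (bcost g * xbar g) (omega * h d)
                    Hg ltac:(lra) ltac:(lra) HBS).
    assert (bcost g * xbar g <= weight1 g omega * u0) by (rewrite <- Eu; nra).
    assert (D1 := stage_value_decreasing_stake g (weight1 g omega * u0)
                    (weight1 g omega * h d) Hg ltac:(nra) ltac:(nra) ltac:(nra)).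
    apply (Rmult_lt_compat_l (delta g)) in D2; [|lra].
    apply (Rmult_le_compat_l (delta g)) in Dg2; lra. }
  assert (Hg0 : gamma d = 0).
  { destruct Hga as [Hga|]; [exfalso|auto].
    assert (D2 := stage_value_decreasing_bonus g (omega * h d) (omega * gamma d)
                    (x2 d) Hg He2 Hn2 ltac:(lra) Hh ltac:(nra)).
    assert (Hfull : omega <> 1 -> x1 d = xbar g).
    { intros Hne; apply Hf1; unfold effort_margin in *.
      pose proof (weight1_gt1 g omega Hg ltac:(lra)); nra. }
    specialize (Hcomp _ _ He1 He2 Hfull).
    rewrite EUP_critical, HEUP in Hcomp by assumption.
    rewrite <- Hh1 in Hcomp.
    replace (bcost g * xbar g) with (omega * h d) in Hcomp
      by (rewrite Hh1; field; lra).
    apply (Rmult_lt_compat_l (delta g)) in D2; lra. }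
  destruct d; unfold critical_design; simpl in *; now rewrite Hh1, Hg0.
Qed.

(** * Efforts where marginal benefit equals unit cost *)

(** The derivative is relative to [0, xbar], so it is tested along the segment
    from x to another effort y, which covers endpoints and interior points
    alike. *)
Lemma directional_derivative (g : params) (x y l eps : R) :
  effort g x -> effort g y -> marginal_benefit g x l -> 0 < eps ->
  exists t, 0 < t <= 1 /\ effort g (t * y + (1 - t) * x) /\
    Rabs (net_benefit g (t * y + (1 - t) * x) - net_benefit g x
          - t * ((l - bcost g) * (y - x))) < t * eps.
Proof.
  intros Hx Hy Hl He.
  destruct (Req_dec y x) as [->|Hne].
  { exists 1; replace (1 * x + (1 - 1) * x) with x by ring.
    repeat split; try lra; try apply Hx.
    replace (_ - _ - _) with 0 by ring; rewrite Rabs_R0; lra. }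
  assert (Hr : 0 < Rabs (y - x)) by (apply Rabs_pos_lt; lra).
  set (r := Rabs (y - x)) in *.
  destruct (Hl (eps / r)) as (alp & Ha & Hlim); [now apply Rdiv_lt_0_compat|].
  set (t := Rmin 1 (alp / (2 * r))).
  assert (Ha2 : 0 < alp / (2 * r)) by (apply Rdiv_lt_0_compat; lra).
  assert (Ht0 : 0 < t) by (unfold t; apply Rmin_glb_lt; lra).
  assert (Ht1 : t <= 1) by apply Rmin_l.
  assert (Htr : t * r < alp).
  { apply Rle_lt_trans with (alp / (2 * r) * r).
    - apply Rmult_le_compat_r; [lra | apply Rmin_r].
    - replace (alp / (2 * r) * r) with (alp / 2) by (field; lra); lra. }
  clearbody t; exists t; set (z := t * y + (1 - t) * x).
  assert (Hz : effort g z) by (unfold effort, z in *; nra).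
  repeat split; try assumption; try apply Hz.
  assert (Ez : z - x = t * (y - x)) by (unfold z; ring).
  assert (Hzx : z - x <> 0)
    by (rewrite Ez; apply Rmult_integral_contrapositive_currified; lra).
  assert (Hzr : Rabs (z - x) = t * r)
    by (rewrite Ez, Rabs_mult, (Rabs_pos_eq t); [reflexivity | lra]).
  assert (Hq : Rabs ((benefit g z - benefit g x) / (z - x) - l) < eps / r).
  { apply Hlim; simpl; unfold Rdist, D_x; rewrite Hzr.
    repeat split; try apply Hz; lra. }
  replace (net_benefit g z - net_benefit g x - t * ((l - bcost g) * (y - x)))
    with (((benefit g z - benefit g x) / (z - x) - l) * (z - x)).
  - rewrite Rabs_mult, Hzr.
    replace (t * eps) with (eps / r * (t * r)) by (field; lra).
    apply Rmult_lt_compat_r; nra.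
  - replace (t * ((l - bcost g) * (y - x))) with ((l - bcost g) * (z - x))
      by (rewrite Ez; ring).
    unfold net_benefit; field; assumption.
Qed.

(** Concavity keeps the difference quotients at x towards y above the slope of
    the chord; let them tend to the derivative. *)
Lemma concave_tangent (g : params) (x y l : R) :
  standing g -> effort g x -> effort g y -> marginal_benefit g x l ->
  net_benefit g y - net_benefit g x <= (l - bcost g) * (y - x).
Proof.
  intros Hg Hx Hy Hl; apply le_epsilon; intros eps He.
  destruct (directional_derivative g x y l eps Hx Hy Hl He) as (t & Ht & _ & Hd).
  assert (Hc := benefit_concave g Hg y x t Hy Hx ltac:(lra)).
  apply Rabs_def2 in Hd; unfold net_benefit in *.
  apply Rmult_le_reg_l with t; nra.
Qed.

Lemma max_slope (g : params) (x y l : R) :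
  effort g x -> effort g y -> marginal_benefit g x l ->
  (forall z, effort g z -> net_benefit g z <= net_benefit g x) ->
  (l - bcost g) * (y - x) <= 0.
Proof.
  intros Hx Hy Hl Hmax; apply le_epsilon; intros eps He.
  destruct (directional_derivative g x y l eps Hx Hy Hl He) as (t & Ht & Hz & Hd).
  specialize (Hmax _ Hz); apply Rabs_def2 in Hd.
  apply Rmult_le_reg_l with t; nra.
Qed.

Lemma stationary_max (g : params) (x y : R) :
  standing g -> effort g x -> effort g y -> marginal_benefit g x (bcost g) ->
  net_benefit g y <= net_benefit g x.
Proof.
  intros Hg Hx Hy Hl; pose proof (concave_tangent g x y _ Hg Hx Hy Hl); lra.
Qed.

(** The slope l - b at x, in the direction of xs, is at most 0 because x is a
    maximizer and at least 0 because xs is one too and the function is concave.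
    Without such an xs, a maximizer at an endpoint could have l <> b. *)
Lemma max_stationary (g : params) (xs x : R) :
  standing g -> effort g xs -> marginal_benefit g xs (bcost g) ->
  effort g x -> (forall z, effort g z -> net_benefit g z <= net_benefit g x) ->
  marginal_benefit g x (bcost g).
Proof.
  intros Hg Hs Hms Hx Hmax.
  destruct (Req_dec xs x) as [<-|Hne]; [assumption|].
  destruct (benefit_diff g Hg x Hx) as [l Hl].
  pose proof (max_slope g x xs l Hx Hs Hl Hmax).
  pose proof (concave_tangent g x xs l Hg Hx Hs Hl).
  pose proof (stationary_max g xs x Hg Hs Hx Hms).
  assert (E : (l - bcost g) * (xs - x) = 0) by lra.
  apply Rmult_integral in E.
  replace (bcost g) with l; [assumption|lra].
Qed.

(** * The optimal design *)

Theorem theorem1 (g : params) (omega xstar : R)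
    (Hg : standing g)
    (Homega : 0 < omega <= 1)
    (Hxstar : effort g xstar)
    (Hmarg : marginal_benefit g xstar (bcost g))
    (Hbig : bcost g * xbar g > sqrt (vcost g * benefit g (xbar g)))
    (d : design)
    (Hopt : optimal g omega d)
    (Hx2 : x2 d <> 0) :
  (gamma d = 0 /\ h d = bcost g * xbar g / omega) /\
  (omega <> 1 ->
     x1 d = xbar g /\ marginal_benefit g (x2 d) (bcost g) /\
     optimal g omega (Design (bcost g * xbar g / omega) 0 (xbar g) xstar)) /\
  (p2 g omega d = 1 /\
   p1 g omega d = omega / (1 + (1 - omega) * delta g) /\
   q2 g omega d = 1 - vcost g / (bcost g * xbar g) /\
   q1 g omega d =
     1 - omega / (1 + (1 - omega) * delta g) * (vcost g / (bcost g * xbar g))).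
Proof.
  assert (Ed := optimal_at_critical g omega d Hg Homega Hbig Hopt Hx2).
  pose proof Hopt as [Hf Hmax].
  assert (HSC := feasible_benefit_gt_vcost g omega d Hg Homega Hf Hx2).
  destruct (full_cost_gt_vcost g Hg HSC Hbig) as [HBC _].
  destruct (incentivized_efforts g omega d Hg Homega Hf) as (_ & _ & Hf1).
  destruct Hf as [_ _ He1 He2 _ _ Hir _].
  set (y1 := x1 d) in *; set (y2 := x2 d) in *; clearbody y1 y2; subst d.
  simpl h in *.
  pose proof (xbar_gt0 g Hg); pose proof (bcost_gt0 g Hg).
  pose proof (vcost_gt0 g Hg); pose proof (full_cost_gt0 g Hg).
  pose proof (delta_in01 g Hg).
  pose proof (weight1_ge1 g omega Hg (proj2 Homega)) as HW.
  assert (Hfull : omega <> 1 -> y1 = xbar g).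
  { intros Hne; apply Hf1; unfold effort_margin.
    pose proof (weight1_gt1 g omega Hg ltac:(lra)).
    assert (Hh : 0 < bcost g * xbar g / omega) by (apply Rdiv_lt_0_compat; lra).
    assert (omega * (bcost g * xbar g / omega) = bcost g * xbar g)
      by (field; lra).
    nra. }
  split; [now split | split].
  - intros Hne; specialize (Hfull Hne); split; [assumption|]; subst y1.
    set (k := 1 - vcost g / (bcost g * xbar g)).
    assert (Hk : 0 < k).
    { unfold k; apply Rlt_0_minus, Rmult_lt_reg_r with (bcost g * xbar g); [lra|].
      unfold Rdiv; rewrite Rmult_assoc, Rinv_l by lra; lra. }
    assert (Hcomp : forall z, effort g z ->
      stage_value g (bcost g * xbar g) 0 z
      <= stage_value g (bcost g * xbar g) 0 y2).
    { intros z Hz.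
      assert (HE := optimal_ge_critical g omega _ (xbar g) z Hg Homega HBC Hopt
                      He1 Hz (fun _ => eq_refl)).
      rewrite !EUP_critical in HE by assumption; nra. }
    (* The outside option at stage 2 is worth 0, hence y2 has positive surplus. *)
    assert (Hpos : 0 < net_benefit g y2).
    { assert (Hc0 := Hcomp 0 (effort_0 g Hg)).
      rewrite (stage_value_critical g y2 Hg Hx2) in Hc0.
      unfold stage_value in Hc0; rewrite unless_outside_0 in Hc0.
      fold k in Hc0; nra. }
    assert (Hnet : forall z, effort g z -> net_benefit g z <= net_benefit g y2).
    { intros z Hz; destruct (Req_dec z 0) as [->|Hz0].
      - unfold net_benefit at 1; rewrite (benefit_at0 g Hg); lra.
      - assert (Hc := Hcomp z Hz).
        rewrite !stage_value_critical in Hc by assumption.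
        fold k in Hc; nra. }
    split; [now apply (max_stationary g xstar)|].
    assert (Hs := stationary_max g xstar y2 Hg Hxstar He2 Hmarg).
    (* At xstar = 0 the design below would leave stage 2 to the outside option. *)
    assert (Hs0 : xstar <> 0).
    { intros ->; unfold net_benefit at 2 in Hs.
      rewrite (benefit_at0 g Hg) in Hs; lra. }
    assert (HE : EUP g omega (critical_design g omega (xbar g) xstar)
                 = EUP g omega (critical_design g omega (xbar g) y2)).
    { rewrite !EUP_critical, !stage_value_critical by assumption.
      now rewrite (Rle_antisym _ _ (Hnet _ Hxstar) Hs). }
    fold (critical_design g omega (xbar g) xstar); split.
    + apply feasible_critical; auto using effort_xbar; rewrite HE; exact Hir.
    + intros d' Hd'; rewrite HE; auto.
  - unfold p1, p2, q1, q2, reputation; simpl.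
    repeat split; try (unfold weight1 in *; field; lra).
    destruct (Req_dec omega 1) as [->|Hne].
    + unfold weight1; field; lra.
    + rewrite (Hfull Hne); unfold weight1 in *; field; lra.
Qed.
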